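(* Let $k \geq 2$ be an integer and let $g = x^k y^k z^k \in \mathbb{C}[x,y,z]$. Then $g$ has no irredundant Waring decomposition of length $(k+1)^2 + 1$.
   Context: For a homogeneous polynomial $g \in \mathbb{C}[x,y,z]$ of degree $d$, a Waring decomposition of $g$ of length $r$ is a set of $r$ distinct points $\mathbb{X} = \{[\ell_1],\dots,[\ell_r]\}$ in the projective plane of linear forms such that $g$ is a linear combination of $\ell_1^d,\dots,\ell_r^d$. It is irredundant if no proper subset $\mathbb{X}' \subsetneq \mathbb{X}$ is a Waring decomposition of $g$. *)

(* Defs.v *)
From mathcomp Require Import all_boot all_order all_algebra.
From mathcomp Require Import finmap mpoly.
From mathcomp Require Import complex.
From mathcomp Require Import reals.

Set Implicit Arguments.
Unset Strict Implicit.
Unset Printing Implicit Defensive.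

Import GRing.Theory.
Local Open Scope ring_scope.
Local Open Scope fset_scope.

Section Waring.
Variable K : fieldType.

Notation linear_form := (dhomog 3 K 1).

(* A point of the projective plane of linear forms is a one-dimensional
   subspace of [linear_form]: the point [ell], for ell != 0, is <[ell]>%VS.
   The representatives [ell p] are irrelevant to the existence of the
   coefficients [c p], since rescaling [ell p] rescales its d-th power. *)
Definition waring_decomposition (d : nat) (g : {mpoly K[3]})
    (X : {fset {vspace linear_form}}) : Prop :=
  exists ell : {vspace linear_form} -> linear_form,
    (forall p, p \in X -> ell p != 0 /\ p = <[ell p]>%VS) /\
    exists c : {vspace linear_form} -> K,
      g = \sum_(p <- X) c p *: (ell p : {mpoly K[3]}) ^+ d.

Definition irredundant_waring_decomposition (d : nat) (g : {mpoly K[3]})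
    (X : {fset {vspace linear_form}}) : Prop :=
  waring_decomposition d g X /\
  forall X' : {fset {vspace linear_form}},
    X' `<` X -> ~ waring_decomposition d g X'.

Definition xyz_power (k : nat) : {mpoly K[3]} :=
  'X_(inord 0) ^+ k * 'X_(inord 1) ^+ k * 'X_(inord 2) ^+ k.

End Waring.

(* Main.v *)
(* Write m = k + 1 and let (x_p, y_p, z_p) be the coordinates of the form at p.
   Irredundance makes every weight c_p nonzero, and comparing coefficients turns
   the decomposition into the quadrature rule
   that, for a + b + e = 3k, the sum of c_p x_p^a y_p^b z_p^e over p is nonzero iff
   a = b = e = k.  On the chart x = 1 it shows, by downward induction on the
   degree, that the m^2 monomials y^b z^e with b, e <= k are independent functions
   on the points, and that few coefficients of a function such as y^m in their
   span W survive.

   If some point has x = 0, then the chart holds exactly m^2 points, so W contains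
   all functions; hence y^m = x^k L and z^m = x^k L' there with L, L' linear.
   Applying the rule to (y^m - x^k L) y^(2k-1) and (z^m - x^k L') z^(2k-1) shows
   that the last point has y = z = 0, which is absurd.

   Otherwise W has codimension 1, and a combination of y^m and z^m is constant, say
   y^m = c + d z^m.  If z^m is in W it is constant too, which leaves at most m^2
   points.  If not, (z - q) z^m and (y - q') z^m are affine functions l and l' for
   some q and q'.  The conic (z - q) l' - (y - q') l vanishes at all the points,
   hence identically, so that l and l' are s (z - q) and s (y - q') for a constant s.
   Thus z^m = s except at one point at most, and there as well because z^m - s has
   weighted sum 0 and the weights are nonzero: z^m is in W after all. *)
Require Import Defs.
From mathcomp Require Import all_boot all_order all_algebra.
From mathcomp Require Import finmap mpoly.
From mathcomp Require Import complex.
From mathcomp Require Import reals.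
From mathcomp Require Import zify ring.

Set Implicit Arguments.
Unset Strict Implicit.
Unset Printing Implicit Defensive.
Import GRing.Theory Num.Theory.
Local Open Scope ring_scope.

(** * Moments on the chart [x = 1] and polynomials with both exponents at most [k] *)

(* The moments up to degree [D] of a multiple of the coefficient functional of
   [(x * y * z) ^ k], read on the chart [x = 1]. *)
Definition affine_moments (K : fieldType) (T : finType) (w y z : T -> K)
    (k : nat) (C : K) (D : nat) : Prop :=
  forall b e, (b + e <= D)%N ->
  \sum_t w t * (y t ^+ b * z t ^+ e) = C *+ ((b == k) && (e == k)).

(** These functions form the space [W]. Coefficients are indexed by all of [nat] so that numerals
    address them; values outside the box are never read. *)
Definition box_poly (K : fieldType) (k : nat) (a : nat -> nat -> K) (y z : K) : K :=
  \sum_(b < k.+1) \sum_(e < k.+1) a b e * (y ^+ b * z ^+ e).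

Lemma affine_moments_eq0 (K : fieldType) (T : finType) (w y z : T -> K) k C D b e :
  affine_moments w y z k C D -> (b + e <= D)%N -> (b != k) || (e != k) ->
  \sum_t w t * (y t ^+ b * z t ^+ e) = 0.
Proof. by move=> hm hbe; rewrite hm // -negb_and => /negbTE ->. Qed.

Lemma affine_momentsC (K : fieldType) (T : finType) (w y z : T -> K) k C D :
  affine_moments w y z k C D -> affine_moments w z y k C D.
Proof.
move=> h b e hbe; rewrite andbC -h 1?addnC //.
by apply: eq_bigr => t _; rewrite [_ ^+ b * _]mulrC.
Qed.

Lemma sum_ord_trunc3 (K : nmodType) k (F : nat -> K) :
  (2 <= k)%N -> (forall i, (3 <= i <= k)%N -> F i = 0) ->
  \sum_(i < k.+1) F i = F 0%N + F 1%N + F 2%N.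
Proof.
case: k => [|[|k]] // _ hF.
rewrite !big_ord_recl /= /bump /= big1 ?addr0 ?addrA // => i _.
by apply: hF; have := ltn_ord i; lia.
Qed.

Lemma box_poly_quadratic (K : fieldType) k (a : nat -> nat -> K) y z :
  (2 <= k)%N -> (forall b e, (b <= k)%N -> (e <= k)%N -> (3 <= b + e)%N -> a b e = 0) ->
  box_poly k a y z = a 0%N 0%N + a 1%N 0%N * y + a 0%N 1%N * z
    + a 2%N 0%N * y ^+ 2 + a 1%N 1%N * (y * z) + a 0%N 2%N * z ^+ 2.
Proof.
move=> hk ha; rewrite /box_poly.
have row (b : 'I_k.+1) : \sum_(e < k.+1) a b e * (y ^+ b * z ^+ e) =
    a b 0%N * y ^+ b + a b 1%N * (y ^+ b * z) + a b 2%N * (y ^+ b * z ^+ 2).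
  rewrite (sum_ord_trunc3 (F := fun e => a b e * (y ^+ b * z ^+ e))) //.
    by rewrite expr0 expr1 mulr1.
  by move=> e he; rewrite ha ?mul0r //; have := ltn_ord b; lia.
rewrite (eq_bigr (fun b : 'I_k.+1 => _) (fun b _ => row b)).
rewrite (sum_ord_trunc3 (F := fun b => a b 0%N * y ^+ b + a b 1%N * (y ^+ b * z)
  + a b 2%N * (y ^+ b * z ^+ 2))) // => [|i hi]; last first.
  by rewrite !ha ?mul0r ?addr0 //; lia.
rewrite (ha 1 2)%N ?(ha 2 1)%N ?(ha 2 2)%N //; try lia; ring.
Qed.

Lemma box_poly_affine (K : fieldType) k (a : nat -> nat -> K) y z :
  (2 <= k)%N -> (forall b e, (b <= k)%N -> (e <= k)%N -> (2 <= b + e)%N -> a b e = 0) ->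
  box_poly k a y z = a 0%N 0%N + a 1%N 0%N * y + a 0%N 1%N * z.
Proof.
move=> hk ha; rewrite box_poly_quadratic //; last by move=> b e ? ? ?; apply: ha; lia.
by rewrite (ha 2 0)%N ?(ha 1 1)%N ?(ha 0 2)%N ?mul0r ?addr0 //; lia.
Qed.

(** * Independence of the monomials on the points, and dimension counts *)

Section BoxPolynomials.
Variables (K : fieldType) (T : finType) (w y z : T -> K) (k : nat) (C : K) (D : nat).
Hypothesis C0 : C != 0.
Hypothesis hD : (2 * k <= D)%N.
Hypothesis hm : affine_moments w y z k C D.

(* Multiplying by [y ^ (k - b) * z ^ (k - e)] and applying the moments isolates
   the coefficient [a b e], provided all coefficients of higher degree vanish. *)
Lemma box_poly_coef_eq0 (r : T -> K) (a : nat -> nat -> K) (s : nat) :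
  (forall t, r t = box_poly k a (y t) (z t)) ->
  (forall b e, (b <= k)%N -> (e <= k)%N -> (s <= b + e)%N ->
     \sum_t w t * (r t * (y t ^+ (k - b) * z t ^+ (k - e))) = 0) ->
  forall b e, (b <= k)%N -> (e <= k)%N -> (s <= b + e)%N -> a b e = 0.
Proof.
move=> ra r0 b e.
have [n] := ubnP (2 * k - (b + e)); elim: n b e => // n IH b e hn hb he hs.
have shift i j t : w t * (a i j * (y t ^+ i * z t ^+ j) *
      (y t ^+ (k - b) * z t ^+ (k - e))) =
    a i j * (w t * (y t ^+ (i + (k - b)) * z t ^+ (j + (k - e)))).
  by rewrite !exprD; ring.
have := r0 b e hb he hs.
under eq_bigr => t _.
  rewrite ra /box_poly mulr_suml mulr_sumr.
  under eq_bigr => i _.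
    rewrite mulr_suml mulr_sumr.
    under eq_bigr => j _ do rewrite shift.
    over.
  over.
rewrite exchange_big /=.
under eq_bigr => i _.
  rewrite exchange_big /=.
  under eq_bigr => j _ do rewrite -mulr_sumr.
  over.
have term (i j : 'I_k.+1) :
   a i j * \sum_t w t * (y t ^+ (i + (k - b)) * z t ^+ (j + (k - e))) =
   a i j * (C *+ ((i == b :> nat) && (j == e :> nat))).
  (* If [i + j <= b + e], the exponents add up to at most [2 * k], where the moments are known;
     otherwise the induction hypothesis kills [a i j]. *)
  have [hij|hij] := leqP (i + j) (b + e).
    rewrite hm; last by lia.
    by congr (_ * (C *+ nat_of_bool (_ && _))); lia.
  rewrite IH ?mul0r //; move: (ltn_ord i) (ltn_ord j); lia.
under eq_bigr => i _ do under eq_bigr => j _ do rewrite term.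
have hb' : (b < k.+1)%N by []; have he' : (e < k.+1)%N by [].
rewrite (bigD1 (Ordinal hb')) //= (bigD1 (Ordinal he')) //= !eqxx mulr1n.
rewrite big1 => [|j hj]; last first.
  by rewrite -[_ == e]/(j == Ordinal he') (negbTE hj) mulr0.
rewrite big1 => [|i hi]; last first.
  by rewrite big1 // => j _; rewrite -[_ == b]/(i == Ordinal hb') (negbTE hi) mulr0.
by rewrite !addr0 => /eqP; rewrite mulf_eq0 (negbTE C0) orbF => /eqP.
Qed.

Lemma box_poly_free (a : nat -> nat -> K) :
  (forall t, box_poly k a (y t) (z t) = 0) ->
  forall b e, (b <= k)%N -> (e <= k)%N -> a b e = 0.
Proof.
move=> h b e hb he; apply: (@box_poly_coef_eq0 (fun=> 0) a 0%N) => // *.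
by apply: big1 => t _; rewrite mul0r mulr0.
Qed.

(** The [k.+1 ^ 2] monomials and the [n] functions, evaluated on [T], are the rows of a matrix with
    fewer columns than rows, hence dependent. By [box_poly_free] the dependency involves some
    [r i]. *)
Lemma box_poly_dependency (n : nat) (r : 'I_n -> T -> K) :
  (#|T| < k.+1 ^ 2 + n)%N ->
  exists l : 'I_n -> K, (exists i, l i != 0) /\
  exists a, forall t, \sum_i l i * r i t = box_poly k a (y t) (z t).
Proof.
rewrite -mulnn => hT.
pose P : finType := ('I_k.+1 * 'I_k.+1)%type.
have [eT eTK] : exists eT : 'I_#|T| -> T, cancel enum_rank eT.
  by exists enum_val; apply: enum_rankK.
have [eP ePK PeK] : exists2 eP : 'I_#|P| -> P, cancel enum_rank eP & cancel eP enum_rank.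
  by exists enum_val; [apply: enum_rankK | apply: enum_valK].
pose A := \matrix_(i, j) (y (eT j) ^+ (eP i).1 * z (eT j) ^+ (eP i).2).
pose B := col_mx A (\matrix_(i, j) r i (eT j)).
have [v [vB v0]] : exists v : 'rV_(_ + n), v *m B = 0 /\ v != 0.
  have : kermx B != 0.
    rewrite kermx_eq0 /row_free neq_ltn (leq_ltn_trans (rank_leq_col _)) //.
    by rewrite card_prod card_ord.
  by case/rowV0Pn => v /sub_kermxP ? ?; exists v.
pose a b e := - lsubmx v 0 (enum_rank (inord b : 'I_k.+1, inord e : 'I_k.+1)).
have va t : \sum_i rsubmx v 0 i * r i t = box_poly k a (y t) (z t).
  have /eqP := congr1 (fun M : 'rV_ _ => M 0 (enum_rank t)) vB.
  rewrite -[v]hsubmxK mul_row_col mxE [X in X + _ == _]mxE [X in _ + X == _]mxE mxE.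
  rewrite row_mxKr addrC addr_eq0.
  under eq_bigr => i _ do rewrite [X in _ * X]mxE eTK.
  under [in X in _ == X]eq_bigr => i _ do rewrite [X in _ * X]mxE eTK.
  move=> /eqP ->; rewrite /box_poly pair_big /= -sumrN (reindex (@enum_rank P)) /=.
    by apply: eq_bigr => -[i j] _; rewrite ePK /a !inord_val mulNr.
  by exists eP => i _; rewrite ?ePK ?PeK.
exists (rsubmx v 0); split; last by exists a.
apply/existsP; apply: contraR v0 => /existsPn h.
have r0 : rsubmx v = 0.
  by apply/rowP => i; rewrite [RHS]mxE; apply/eqP; have:= h i; rewrite negbK.
have a0 (b e : 'I_k.+1) : a b e = 0.
  have le_k (i : 'I_k.+1) : (i <= k)%N by rewrite -ltnS.
  apply: (@box_poly_free a) => // t; rewrite -va.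
  by apply: big1 => j _; rewrite r0 mxE mul0r.
rewrite -[v]hsubmxK r0; suff -> : lsubmx v = 0 by rewrite row_mx0.
apply/rowP => p; rewrite [RHS]mxE -[p]PeK; case: (eP p) => b e.
by apply/eqP; rewrite -oppr_eq0 -(a0 b e) /a !inord_val.
Qed.

(** The case [n = 0] of the dependency: a nonzero [l i] would have its index in the empty type
    ['I_0]. *)
Lemma card_box_le : (k.+1 ^ 2 <= #|T|)%N.
Proof.
rewrite leqNgt; apply/negP => h.
have [|l [[i _] _]] := @box_poly_dependency 0 (fun=> fun=> 0).
  by rewrite addn0.
by case: i.
Qed.

Lemma box_poly_dependency2 (r s : T -> K) :
  (#|T| <= (k.+1 ^ 2).+1)%N ->
  exists c d a, (c != 0) || (d != 0) /\
    forall t, c * r t + d * s t = box_poly k a (y t) (z t).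
Proof.
move=> hT; pose f (i : 'I_2) := if i == 0 then r else s.
have [|l [[i li] [a ha]]] := @box_poly_dependency 2 f; first by rewrite addn2.
exists (l 0), (l 1), a; split=> [|t]; last first.
  rewrite -ha !big_ord_recl big_ord0 addr0 (_ : lift ord0 ord0 = 1) //.
  exact/val_inj.
apply: contraNT li; rewrite negb_or !negbK => /andP [/eqP l0 /eqP l1].
have [->|i0] := eqVneq i 0; first by rewrite l0.
by rewrite (_ : i = 1) ?l1 //; apply/val_inj; case: i i0 => [[|[|]]].
Qed.

End BoxPolynomials.

Lemma box_polyZ (K : fieldType) k (c : K) (a : nat -> nat -> K) y z :
  box_poly k (fun b e => c * a b e) y z = c * box_poly k a y z.
Proof.
rewrite /box_poly mulr_sumr; apply: eq_bigr => b _.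
by rewrite mulr_sumr; apply: eq_bigr => e _; rewrite -mulrA.
Qed.

(** Each coordinate is a root of some [X^n - u], so it takes at most [n] values. *)
Lemma card_powers_const (K : fieldType) (T : finType) (y z : T -> K) n (c d : K) :
  (0 < n)%N -> injective (fun t => (y t, z t)) ->
  (forall t, y t ^+ n = c) -> (forall t, z t ^+ n = d) -> (#|T| <= n ^ 2)%N.
Proof.
move=> n0 inj hy hz.
have roots (f : T -> K) (r : K) : (forall t, f t ^+ n = r) ->
    (size (undup (codom f)) <= n)%N.
  move=> hf; rewrite -ltnS -(size_XnsubC r n0); apply: max_poly_roots.
  - by rewrite -size_poly_eq0 size_XnsubC.
  - apply/allP => u; rewrite mem_undup => /codomP [t ->].
    by rewrite rootE !hornerE hf subrr.
  - exact: undup_uniq.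
rewrite cardT -(size_map (fun t => (y t, z t))) -mulnn.
apply: leq_trans (leq_mul (roots _ _ hy) (roots _ _ hz)).
rewrite -(size_allpairs pair); apply: uniq_leq_size.
  by rewrite map_inj_uniq ?enum_uniq.
move=> u /mapP [t _ ->]; apply: allpairs_f; rewrite mem_undup; exact: codom_f.
Qed.

(** * Point sets contained in the chart *)

Section AffinePoints.
Variables (K : fieldType) (T : finType) (w y z : T -> K) (k : nat) (C : K).
Hypothesis k2 : (2 <= k)%N.
Hypothesis C0 : C != 0.

(** With so few points every function is a box polynomial; the vanishing sums then remove all
    coefficients of degree 2 or more. *)
Lemma affine_of_card_le (r : T -> K) D :
  (2 * k <= D)%N -> affine_moments w y z k C D -> (#|T| <= k.+1 ^ 2)%N ->
  (forall b e, (b <= k)%N -> (e <= k)%N -> (2 <= b + e)%N ->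
     \sum_t w t * (r t * (y t ^+ (k - b) * z t ^+ (k - e))) = 0) ->
  exists a0 a1 a2, forall t, r t = a0 + a1 * y t + a2 * z t.
Proof.
move=> hD hm hT hr.
have [|l [[i li] [a ha]]] := box_poly_dependency C0 hD hm (n := 1) (fun=> r).
  by rewrite addn1.
rewrite (ord1 i) in li.
have {}ha t : r t = box_poly k (fun b e => (l 0)^-1 * a b e) (y t) (z t).
  by rewrite box_polyZ -ha big_ord1 mulKf.
have a2 := box_poly_coef_eq0 C0 hD hm ha hr.
by eexists _, _, _ => t; rewrite ha (box_poly_affine _ _ k2).
Qed.

Hypothesis hm : affine_moments w y z k C (3 * k).

Lemma double_le_triple : (2 * k <= 3 * k)%N.
Proof. by rewrite leq_mul2r orbT. Qed.

Lemma const_of_box_poly (r : T -> K) (a : nat -> nat -> K) :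
  (forall t, r t = box_poly k a (y t) (z t)) ->
  (forall b e, (b <= k)%N -> (e <= k)%N -> (1 <= b + e)%N ->
     \sum_t w t * (r t * (y t ^+ (k - b) * z t ^+ (k - e))) = 0) ->
  forall t, r t = a 0%N 0%N.
Proof.
move=> ha hr t.
have a0 := box_poly_coef_eq0 C0 double_le_triple hm ha hr.
rewrite ha (box_poly_affine _ _ k2) => [|b e *]; last by apply: a0; lia.
by rewrite (a0 1 0)%N ?(a0 0 1)%N ?mul0r ?addr0 //; lia.
Qed.

(** The exponent [2k + 1 - e] of [z] exceeds [k], and [1 <= b + e] keeps the total degree
    [3k + 1 - b - e] within the known range. *)
Lemma moment_z_pow b e : (b <= k)%N -> (e <= k)%N -> (1 <= b + e)%N ->
  \sum_t w t * (z t ^+ k.+1 * (y t ^+ (k - b) * z t ^+ (k - e))) = 0.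
Proof.
move=> hb he h.
under eq_bigr => t _ do rewrite [z t ^+ _ * _]mulrCA -exprD.
by apply: (affine_moments_eq0 hm); lia.
Qed.

Hypothesis w0 : forall t, w t != 0.
Hypothesis yz_inj : injective (fun t => (y t, z t)).
Hypothesis cardT : #|T| = (k.+1 ^ 2).+1.

Lemma no_linear_relation (c d : K) :
  (forall t, y t ^+ k.+1 = c + d * z t ^+ k.+1) -> False.
Proof.
move=> hy.
have z_notin a : (forall t, z t ^+ k.+1 = box_poly k a (y t) (z t)) -> False.
  move=> ha; have zc := const_of_box_poly ha moment_z_pow.
  have yc t : y t ^+ k.+1 = c + d * a 0%N 0%N by rewrite hy zc.
  by have := card_powers_const (ltn0Sn k) yz_inj yc zc; rewrite cardT ltnn.
(* [W] has codimension 1 and misses [z ^ k.+1], so [r] is a multiple of [z ^ k.+1] modulo [W]; the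
   vanishing sums make the remainder affine. *)
have rel (r : T -> K) :
    (forall b e, (b <= k)%N -> (e <= k)%N -> (2 <= b + e)%N ->
     \sum_t w t * (r t * (y t ^+ (k - b) * z t ^+ (k - e))) = 0) ->
    exists q a0 a1 a2, forall t,
      r t = q * z t ^+ k.+1 + a0 + a1 * y t + a2 * z t.
  move=> hr.
  have [|c1 [d1 [a [cd ha]]]] := box_poly_dependency2 C0 double_le_triple hm r
    (fun t => z t ^+ k.+1); first by rewrite cardT.
  have c10 : c1 != 0.
    apply: contraPneq (z_notin (fun b e => d1^-1 * a b e)) => c10.
    move: cd; rewrite c10 eqxx /= => d10.
    by case=> t; rewrite box_polyZ -ha c10 mul0r add0r mulKf.
  have [q qE] : exists q, q = - c1^-1 * d1 by eexists.
  pose r' t := r t - q * z t ^+ k.+1.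
  have {}ha t : r' t = box_poly k (fun b e => c1^-1 * a b e) (y t) (z t).
    by rewrite /r' qE box_polyZ -ha mulrDr mulKf // !mulNr opprK mulrA.
  have hr' b e : (b <= k)%N -> (e <= k)%N -> (2 <= b + e)%N ->
     \sum_t w t * (r' t * (y t ^+ (k - b) * z t ^+ (k - e))) = 0.
    move=> hb he h.
    have split t M : w t * (r' t * M) = w t * (r t * M) - q * (w t * (z t ^+ k.+1 * M)).
      by rewrite /r'; ring.
    under eq_bigr => t _ do rewrite split.
    by rewrite sumrB hr // -mulr_sumr moment_z_pow ?mulr0 ?subr0 //; lia.
  have a2 := box_poly_coef_eq0 C0 double_le_triple hm ha hr'.
  eexists q, _, _, _ => t.
  have := ha t; rewrite (box_poly_affine _ _ k2) // => /(canRL (subrK _)) ->.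
  by rewrite addrC !addrA.
(* Against the test monomials, [z ^ k.+2] and [y * z ^ k.+1] both have total degree [3k + 2 - b - e]
   and more than [k] factors [z], so the sums vanish once [2 <= b + e]. *)
have [b e hb he h|q [a0 [a1 [a2 hz]]]] := rel (fun t => z t ^+ k.+2).
  under eq_bigr => t _ do rewrite [z t ^+ _ * _]mulrCA -exprD.
  by apply: (affine_moments_eq0 hm); lia.
have [b e hb he h|q' [b0 [b1 [b2 hyz]]]] := rel (fun t => y t * z t ^+ k.+1).
  under eq_bigr => t _ do rewrite mulrACA -exprS -exprD.
  by apply: (affine_moments_eq0 hm); lia.
(* Both relations say that [(z ^ k.+1, 1)] is in the kernel of a matrix of affine
   forms; its determinant is the following conic. *)
pose conic b e := match b, e return K with
  | 0%N, 0%N => q' * a0 - q * b0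
  | 1%N, 0%N => q' * a1 - q * b1 - a0
  | 0%N, 1%N => q' * a2 - q * b2 + b0
  | 2%N, 0%N => - a1
  | 1%N, 1%N => b1 - a2
  | 0%N, 2%N => b2
  | _, _ => 0
  end.
have conic0 t : box_poly k conic (y t) (z t) = 0.
  rewrite box_poly_quadratic //; last by case=> [|[|[|b]]] [|[|[|e]]].
  rewrite /conic; have := hz t; have := hyz t; rewrite [_ ^+ k.+2]exprS => h1 h2.
  have -> : q' * a0 - q * b0 + (q' * a1 - q * b1 - a0) * y t +
     (q' * a2 - q * b2 + b0) * z t + - a1 * y t ^+ 2 + (b1 - a2) * (y t * z t) +
     b2 * z t ^+ 2 = (z t - q) * (b0 + b1 * y t + b2 * z t)
       - (y t - q') * (a0 + a1 * y t + a2 * z t) by ring.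
  have -> : b0 + b1 * y t + b2 * z t = (y t - q') * z t ^+ k.+1.
    by rewrite mulrBl h1; ring.
  have -> : a0 + a1 * y t + a2 * z t = (z t - q) * z t ^+ k.+1.
    by rewrite mulrBl h2; ring.
  by ring.
(* Since [2 <= k], the conic lies in the box and all its coefficients vanish. The two affine forms
   become [a2 * (z - q)] and [a2 * (y - q')]. *)
have cf := box_poly_free C0 double_le_triple hm conic0.
have /eqP := cf 2%N 0%N k2 isT; rewrite oppr_eq0 => /eqP a10.
have b20 : b2 = 0 := cf 0%N 2%N isT k2.
have /eqP := cf 1%N 1%N (ltnW k2) (ltnW k2); rewrite subr_eq0 => /eqP b1a2.
have /eqP := cf 1%N 0%N (ltnW k2) isT.
rewrite /= a10 mulr0 sub0r b1a2 subr_eq0 => /eqP a0E.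
have /eqP := cf 0%N 1%N isT (ltnW k2).
rewrite /= b20 mulr0 subr0 addrC addr_eq0 => /eqP b0E.
have zs t : z t ^+ k.+1 = a2 \/ (y t, z t) = (q', q).
  have h1 : (z t - q) * (z t ^+ k.+1 - a2) = 0.
    have := hz t; rewrite [_ ^+ k.+2]exprS a10 -a0E => h; rewrite mulrBl mulrBr h; ring.
  have h2 : (y t - q') * (z t ^+ k.+1 - a2) = 0.
    have := hyz t; rewrite b20 b1a2 b0E => h; rewrite mulrBl mulrBr h; ring.
  have [->|h0] := eqVneq (z t ^+ k.+1) a2; [by left | right].
  move/eqP: h1; move/eqP: h2; rewrite !mulf_eq0 !subr_eq0 (negbTE h0) !orbF.
  by move=> /eqP -> /eqP ->.
have zall t : z t ^+ k.+1 = a2.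
  case: (zs t) => // ht.
  (* By injectivity [t] is the only exceptional point, so this sum reduces to its term at [t]. *)
  have : \sum_t w t * (z t ^+ k.+1 - a2) = 0.
    have m1 : \sum_t w t * (y t ^+ 0 * z t ^+ k.+1) = 0.
      by apply: (affine_moments_eq0 hm); lia.
    have m0 : \sum_t w t * (y t ^+ 0 * z t ^+ 0) = 0.
      by apply: (affine_moments_eq0 hm); lia.
    transitivity (\sum_t w t * (y t ^+ 0 * z t ^+ k.+1)
        - (\sum_t w t * (y t ^+ 0 * z t ^+ 0)) * a2); last by rewrite m1 m0 mul0r subr0.
    rewrite mulr_suml -sumrB.
    by apply: eq_bigr => u _; rewrite !expr0 mul1r !mulr1 mulrBr.
  rewrite (bigD1 t) //= big1 ?addr0 => [|u hu].
    by move/eqP; rewrite mulf_eq0 (negbTE (w0 t)) subr_eq0 => /eqP.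
  case: (zs u) => [->|hu']; first by rewrite subrr mulr0.
  by case/eqP: hu; apply: yz_inj; rewrite hu' ht.
apply: (z_notin (fun b e => if (b + e == 0)%N then a2 else 0)) => t.
rewrite zall (box_poly_affine _ _ k2) => [|b e _ _ h].
  by rewrite !mul0r !addr0.
by rewrite ifN //; lia.
Qed.

End AffinePoints.

Lemma no_affine_points (K : fieldType) (T : finType) (w y z : T -> K) (k : nat) (C : K) :
  (2 <= k)%N -> C != 0 -> (forall t, w t != 0) ->
  injective (fun t => (y t, z t)) -> affine_moments w y z k C (3 * k) ->
  #|T| <> (k.+1 ^ 2).+1.
Proof.
move=> k2 C0 w0 inj hm hT.
have hD := double_le_triple k.
have [|c [d [a [cd ha]]]] := box_poly_dependency2 C0 hD hm
  (fun t => y t ^+ k.+1) (fun t => z t ^+ k.+1); first by rewrite hT.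
have hc := const_of_box_poly k2 C0 hm ha.
have {hc} hc : forall t, c * y t ^+ k.+1 + d * z t ^+ k.+1 = a 0%N 0%N.
  apply: hc => b e hb he h.
  have split t : w t * ((c * y t ^+ k.+1 + d * z t ^+ k.+1) *
        (y t ^+ (k - b) * z t ^+ (k - e)))
      = c * (w t * (y t ^+ (k.+1 + (k - b)) * z t ^+ (k - e)))
        + d * (w t * (y t ^+ (k - b) * z t ^+ (k.+1 + (k - e)))).
    by rewrite !exprD; ring.
  under eq_bigr => t _ do rewrite split.
  rewrite big_split /= -!mulr_sumr.
  by rewrite !(affine_moments_eq0 hm) ?mulr0 ?addr0 //; lia.
(* If [c] is nonzero, solve for [y ^ k.+1]. Otherwise [z ^ k.+1] is constant, and the roles of [y]
   and [z] are exchanged. *)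
have [c0|c0] := eqVneq c 0; last first.
  apply: (no_linear_relation k2 C0 hm w0 inj hT (c := c^-1 * a 0%N 0%N)
            (d := - c^-1 * d)) => t.
  by rewrite -(hc t) mulrDr mulKf // !mulNr mulrA addrK.
have d0 : d != 0 by move: cd; rewrite c0 eqxx.
have inj' : injective (fun t => (z t, y t)).
  by move=> t u [h1 h2]; apply: inj; rewrite h1 h2.
apply: (no_linear_relation k2 C0 (affine_momentsC hm) w0 inj' hT
  (c := d^-1 * a 0%N 0%N) (d := 0)) => t.
by rewrite -(hc t) c0 !mul0r add0r mulKf // addr0.
Qed.

(** * Projective point sets, possibly meeting the line [x = 0] *)

Lemma no_projective_points (K : fieldType) (T : finType) (c x y z : T -> K)
    (k : nat) (C : K) :
  (2 <= k)%N -> C != 0 -> (forall t, c t != 0) ->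
  (forall t, x t = 0 -> y t = 0 -> z t = 0 -> False) ->
  (forall t u l, x t = l * x u -> y t = l * y u -> z t = l * z u -> t = u) ->
  (forall a b e, (a + b + e = 3 * k)%N ->
     \sum_t c t * (x t ^+ a * y t ^+ b * z t ^+ e) =
     C *+ [&& a == k, b == k & e == k]) ->
  #|T| <> (k.+1 ^ 2).+1.
Proof.
move=> k2 C0 c0 nz inj hm hT.
pose S := {t : T | x t != 0}.
(* The weight absorbs [x ^ (3 * k)], so that moments of [Y] and [Z] become homogeneous moments of
   degree [3k]. *)
pose w (s : S) := c (val s) * x (val s) ^+ (3 * k).
pose Y (s : S) := y (val s) / x (val s).
pose Z (s : S) := z (val s) / x (val s).
have x0 (s : S) : x (val s) != 0 := valP s.
have w0 s : w s != 0 by rewrite mulf_neq0 // expf_neq0.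
have YZ_inj : injective (fun s => (Y s, Z s)).
  move=> s u [hY hZ]; apply/val_inj/(inj _ _ (x (val s) / x (val u))).
  - by rewrite divfK.
  - by rewrite mulrAC -mulrA -/(Y u) -hY mulrC divfK.
  - by rewrite mulrAC -mulrA -/(Z u) -hZ mulrC divfK.
have term s b e : (b + e <= 3 * k)%N -> w s * (Y s ^+ b * Z s ^+ e) =
    c (val s) * (x (val s) ^+ (3 * k - b - e) * y (val s) ^+ b * z (val s) ^+ e).
  move=> hbe; rewrite /w /Y /Z !expr_div_n.
  have -> : (3 * k = (3 * k - b - e) + b + e)%N by lia.
  rewrite !exprD (_ : _ + b + e - b - e = 3 * k - b - e)%N; last by lia.
  by field; rewrite !expf_neq0.
have sumS (F : T -> K) : (forall t, x t = 0 -> F t = 0) ->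
    \sum_(s : S) F (val s) = \sum_t F t.
  move=> hF; rewrite -(big_sub (fun t => x t != 0)) [RHS](bigID (fun t => x t != 0)) /=.
  by rewrite [X in _ + X]big1 ?addr0 // => t; rewrite negbK => /eqP /hF.
(* Points with [x = 0] contribute only through [x ^ 0], that is, when [b + e = 3 * k]; in lower
   degree the chart carries the full moment. *)
have momS b e : (b + e <= 3 * k)%N -> (b + e < 3 * k)%N \/ (forall t, x t != 0) ->
    \sum_s w s * (Y s ^+ b * Z s ^+ e) = C *+ ((b == k) && (e == k)).
  move=> hbe hx; under eq_bigr => s _ do rewrite term //.
  rewrite (sumS (fun t => c t * (x t ^+ _ * y t ^+ _ * z t ^+ _))); last first.
    move=> t xt; case: hx => [h|/(_ t)]; last by rewrite xt eqxx.
    by rewrite xt expr0n (_ : (_ == 0)%N = false) ?mul0r ?mulr0 //; lia.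
  by rewrite hm; [congr (C *+ nat_of_bool _)|]; lia.
have [/existsP [t0 /eqP xt0]|/existsPn allx] := boolP [exists t, x t == 0]; last first.
  apply: (no_affine_points k2 C0 w0 YZ_inj (_ : affine_moments w Y Z k C (3 * k))).
    by move=> b e hbe; apply: momS => //; right.
  rewrite card_sig -hT; apply: eq_card => t.
  by rewrite !inE (allx t).
have mom1 : affine_moments w Y Z k C (3 * k).-1.
  by move=> b e hbe; apply: momS; [|left]; lia.
have hD : (2 * k <= (3 * k).-1)%N by lia.
have cardS : (#|{: S}| + #|[pred t | x t == 0%R]| = (k.+1 ^ 2).+1)%N.
  rewrite -hT card_sig -[RHS](cardC [pred t | x t == 0%R]) addnC.
  by congr (_ + _)%N; apply: eq_card => t; rewrite !inE.
have card0 : (0 < #|[pred t | x t == 0%R]|)%N.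
  by apply/card_gt0P; exists t0; rewrite inE xt0.
(* The chart has at least [k.+1 ^ 2] points and misses at least one, so it misses exactly [t0]. *)
have cardS_ge := card_box_le C0 hD mom1.
have t0_uniq t : x t = 0 -> t = t0.
  have /card_le1_eqP h : (#|[pred t | x t == 0%R]| <= 1)%N.
    by rewrite -(leq_add2l #|{: S}|) cardS addn1 ltnS.
  by move=> xt; apply: h; rewrite inE ?xt ?xt0.
have cardS_le : (#|{: S}| <= k.+1 ^ 2)%N.
  by rewrite -ltnS -cardS -[X in (X < _)%N]addn0 ltn_add2l.
(* [V] will be [y] or [z]. On the chart [V ^ k.+1] equals [x ^ k] times a linear form. The
   difference times [c * V ^ (2k - 1)] vanishes off [t0] and sums to zero by the last four
   hypotheses, while at [t0] it is [c * V ^ (3k)]. *)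
have vanish (V : T -> K) :
    (forall b e, (b <= k)%N -> (e <= k)%N -> (2 <= b + e)%N ->
      \sum_s w s * ((V (val s) / x (val s)) ^+ k.+1 *
        (Y s ^+ (k - b) * Z s ^+ (k - e))) = 0) ->
    \sum_t c t * V t ^+ (3 * k) = 0 ->
    \sum_t c t * (x t ^+ k.+1 * V t ^+ (2 * k).-1) = 0 ->
    \sum_t c t * (x t ^+ k * y t * V t ^+ (2 * k).-1) = 0 ->
    \sum_t c t * (x t ^+ k * z t * V t ^+ (2 * k).-1) = 0 ->
    V t0 = 0.
  move=> hV s1 s2 s3 s4.
  have [a0 [a1 [a2 rel]]] := affine_of_card_le k2 C0 hD mom1 cardS_le hV.
  pose F t := c t * V t ^+ (3 * k) - (a0 * (c t * (x t ^+ k.+1 * V t ^+ (2 * k).-1))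
    + a1 * (c t * (x t ^+ k * y t * V t ^+ (2 * k).-1))
    + a2 * (c t * (x t ^+ k * z t * V t ^+ (2 * k).-1))).
  have FE t : F t = c t * V t ^+ (2 * k).-1 *
      (V t ^+ k.+1 - x t ^+ k * (a0 * x t + a1 * y t + a2 * z t)).
    rewrite /F (_ : 3 * k = (2 * k).-1 + k.+1)%N; last by lia.
    rewrite exprD [x t ^+ k.+1]exprS; move: (V t ^+ _) (V t ^+ _) => u v; ring.
  have : \sum_t F t = 0.
    by rewrite sumrB !big_split /= -!mulr_sumr s1 s2 s3 s4 !mulr0 !addr0 subr0.
  rewrite (bigD1 t0) //= big1 => [|t tt0].
    rewrite addr0 FE xt0 expr0n (_ : (k == 0)%N = false) /= ?mul0r ?subr0; last by lia.
    rewrite -mulrA -exprD => /eqP; rewrite mulf_eq0 (negbTE (c0 _)) /=.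
    by rewrite expf_eq0 => /andP [_ /eqP].
  have xt : x t != 0 by apply: contra_neq tt0; apply: t0_uniq.
  have := rel (Sub t xt); rewrite /Y /Z SubK => h.
  rewrite FE -[V t](divfK xt) [X in _ - X](_ : _ = (V t / x t) ^+ k.+1 * x t ^+ k.+1).
    by rewrite [X in _ * (X - _)]exprMn subrr mulr0.
  by rewrite h exprS; field.
have hm0 a b e : (a + b + e = 3 * k)%N -> ~~ [&& a == k, b == k & e == k] ->
    \sum_t c t * (x t ^+ a * y t ^+ b * z t ^+ e) = 0.
  by move=> h /negbTE n; rewrite hm // n.
apply: (nz t0) => //.
- apply: vanish.
  + move=> b e hb he h.
    under eq_bigr => s _ do rewrite [_ ^+ k.+1 * _]mulrA -exprD.
    by apply: (affine_moments_eq0 mom1); lia.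
  + apply: eq_trans (hm0 0 (3 * k) 0 _ _)%N; try lia.
    by apply: eq_bigr => t _; rewrite !expr0 mul1r mulr1.
  + apply: eq_trans (hm0 k.+1 (2 * k).-1 0 _ _)%N; try lia.
    by apply: eq_bigr => t _; rewrite expr0 mulr1.
  + apply: eq_trans (hm0 k (2 * k).-1.+1 0 _ _)%N; try lia.
    by apply: eq_bigr => t _; rewrite expr0 mulr1 exprS !mulrA.
  + apply: eq_trans (hm0 k (2 * k).-1 1 _ _)%N; try lia.
    by apply: eq_bigr => t _; rewrite expr1 mulrAC.
- apply: vanish.
  + move=> b e hb he h.
    under eq_bigr => s _ do rewrite [_ ^+ k.+1 * _]mulrCA -exprD.
    by apply: (affine_moments_eq0 mom1); lia.
  + apply: eq_trans (hm0 0 0 (3 * k) _ _)%N; try lia.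
    by apply: eq_bigr => t _; rewrite !expr0 !mul1r.
  + apply: eq_trans (hm0 k.+1 0 (2 * k).-1 _ _)%N; try lia.
    by apply: eq_bigr => t _; rewrite expr0 mulr1.
  + by apply: eq_trans (hm0 k 1 (2 * k).-1 _ _)%N; try lia.
  + apply: eq_trans (hm0 k 0 (2 * k).-1.+1 _ _)%N; try lia.
    by apply: eq_bigr => t _; rewrite expr0 mulr1 exprS !mulrA.
Qed.

(** * From Waring decompositions to moments *)

Definition mon3 (a b e : nat) : 'X_{1..3} :=
  (U_(inord 0) *+ a + U_(inord 1) *+ b + U_(inord 2) *+ e)%MM.

Lemma mon3_eq a b e a' b' e' :
  (mon3 a b e == mon3 a' b' e') = [&& a == a', b == b' & e == e'].
Proof.
apply/eqP/and3P => [h|[/eqP -> /eqP -> /eqP ->] //].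
have ev i := congr1 (fun m : 'X_{1..3} => m i) h.
have n01 : (inord 0 == inord 1 :> 'I_3) = false by rewrite -val_eqE /= !inordK.
have n02 : (inord 0 == inord 2 :> 'I_3) = false by rewrite -val_eqE /= !inordK.
have n12 : (inord 1 == inord 2 :> 'I_3) = false by rewrite -val_eqE /= !inordK.
have := (ev (inord 0), ev (inord 1), ev (inord 2)).
rewrite /= !mnmDE !mulmnE !mnm1E !eqxx n01 n02 n12 [inord 1 == _]eq_sym n01.
rewrite [inord 2 == _]eq_sym n02 [inord 2 == _]eq_sym n12.
by rewrite !mul1n !mul0n !addn0 !add0n => -[[-> ->] ->].
Qed.

Lemma mpolyX_mon3 (K : fieldType) a b e :
  'X_(inord 0) ^+ a * 'X_(inord 1) ^+ b * 'X_(inord 2) ^+ e =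
  'X_[mon3 a b e] :> {mpoly K[3]}.
Proof. by rewrite !mpolyXn -!mpolyXD. Qed.

Lemma linear_formE (K : fieldType) (l : dhomog 3 K 1) :
  (l : {mpoly K[3]}) = (l : {mpoly K[3]})@_U_(inord 0) *: 'X_(inord 0)
    + (l : {mpoly K[3]})@_U_(inord 1) *: 'X_(inord 1)
    + (l : {mpoly K[3]})@_U_(inord 2) *: 'X_(inord 2).
Proof.
transitivity (\sum_(i < 3) (l : {mpoly K[3]})@_U_(i) *: 'X_i).
  apply/mpolyP => m; rewrite raddf_sum /=.
  under eq_bigr => i _ do rewrite mcoeffZ mcoeffX.
  have [/mdeg1P [i /eqP ->]|hm] := boolP (mdeg m == 1%N).
    rewrite (bigD1 i) //= eqxx mulr1 big1 ?addr0 // => j hj.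
    by rewrite eq_mnm1 (negbTE hj) mulr0.
  rewrite (dhomog_nemf_coeff (dhomog_is_dhomog l) hm) big1 // => i _.
  rewrite (_ : (_ == m) = false) ?mulr0 //.
  by apply: contraNF hm => /eqP <-; rewrite mdeg1.
rewrite !big_ord_recl big_ord0 addr0 addrA.
have [-> -> ->] : [/\ inord 0 = ord0 :> 'I_3, inord 1 = lift ord0 ord0 :> 'I_3 &
    inord 2 = lift ord0 (lift ord0 ord0) :> 'I_3].
  by split; apply/val_inj; rewrite /= inordK.
by [].
Qed.

Lemma linear_form_scale (K : fieldType) (l l' : dhomog 3 K 1) (s : K) :
  (l : {mpoly K[3]})@_U_(inord 0) = s * (l' : {mpoly K[3]})@_U_(inord 0) ->
  (l : {mpoly K[3]})@_U_(inord 1) = s * (l' : {mpoly K[3]})@_U_(inord 1) ->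
  (l : {mpoly K[3]})@_U_(inord 2) = s * (l' : {mpoly K[3]})@_U_(inord 2) ->
  l = s *: l'.
Proof.
move=> h0 h1 h2; apply/val_inj.
by rewrite /= linear_formE h0 h1 h2 -!scalerA -!scalerDr -linear_formE.
Qed.

(** Two nested binomial expansions; the product of binomials is the trinomial coefficient
    [d! / (a! b! e!)]. *)
Lemma mcoeff_pow_linear (K : fieldType) (x y z : K) d a b e : (a + b + e = d)%N ->
  ((x *: 'X_(inord 0) + y *: 'X_(inord 1) + z *: 'X_(inord 2)) ^+ d)@_(mon3 a b e)
  = ('C(d, b + e) * 'C(b + e, e))%:R * (x ^+ a * y ^+ b * z ^+ e).
Proof.
move=> hd; rewrite -addrA exprDn raddf_sum /=.
have term (i j : nat) : (x *: 'X_(inord 0) : {mpoly K[3]}) ^+ (d - i) *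
   ((y *: 'X_(inord 1)) ^+ (i - j) * (z *: 'X_(inord 2)) ^+ j) =
   (x ^+ (d - i) * y ^+ (i - j) * z ^+ j) *: 'X_[mon3 (d - i) (i - j) j].
  rewrite !exprZn -mpolyX_mon3 -!scalerAl -!scalerAr !scalerA.
  by rewrite !mulrA.
have be : (b + e < d.+1)%N by lia.
have ee : (e < (b + e).+1)%N by lia.
rewrite (bigD1 (Ordinal be)) //= [X in _ + X]big1 => [|i hi].
  rewrite addr0 mcoeffMn exprDn mulr_sumr raddf_sum /= (bigD1 (Ordinal ee)) //=.
  rewrite [X in _ + X]big1 => [|j hj].
    rewrite addr0 mulrnAr mcoeffMn term mcoeffZ mcoeffX.
    rewrite (_ : (d - (b + e) = a)%N); last by lia.
    rewrite (_ : (b + e - e = b)%N); last by lia.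
    by rewrite eqxx mulr1 -mulrnA mulr_natl mulnC.
  rewrite mulrnAr mcoeffMn term mcoeffZ mcoeffX mon3_eq.
  rewrite [X in [&& _, _ & X]](_ : _ = false) ?andbF ?mulr0 ?mul0rn //.
  exact: negbTE hj.
rewrite mcoeffMn exprDn mulr_sumr raddf_sum /= big1 ?mul0rn // => j _.
rewrite mulrnAr mcoeffMn term mcoeffZ mcoeffX mon3_eq.
rewrite (_ : [&& _, _ & _] = false) ?mulr0 ?mul0rn //.
have : i != b + e :> nat by exact: hi.
have := ltn_ord i; have := ltn_ord j; lia.
Qed.

(** Comparing coefficients at [mon3 a b e], the trinomial factor is the same for all points and
    nonzero in characteristic 0, so it can be divided out. *)
Lemma moments_of_waring (K : numFieldType) (T : finType) (c : T -> K)
    (l : T -> dhomog 3 K 1) k a b e :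
  xyz_power K k = \sum_t c t *: (l t : {mpoly K[3]}) ^+ (3 * k) ->
  (a + b + e = 3 * k)%N ->
  \sum_t c t * ((l t : {mpoly K[3]})@_U_(inord 0) ^+ a *
    (l t : {mpoly K[3]})@_U_(inord 1) ^+ b * (l t : {mpoly K[3]})@_U_(inord 2) ^+ e) =
  ('C(3 * k, 2 * k) * 'C(2 * k, k))%:R^-1 *+ [&& a == k, b == k & e == k].
Proof.
move=> hg habe; have := congr1 (mcoeff (mon3 a b e)) hg.
rewrite /xyz_power mpolyX_mon3 mcoeffX mon3_eq raddf_sum /=.
under eq_bigr => t _.
  rewrite mcoeffZ [X in X ^+ (3 * k)]linear_formE mcoeff_pow_linear // mulrCA.
  over.
rewrite -mulr_sumr ![k == _]eq_sym => h.
have m0 : ('C(3 * k, b + e) * 'C(b + e, e))%:R != 0 :> K.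
  by rewrite pnatr_eq0 muln_eq0 negb_or -!lt0n !bin_gt0; apply/andP; split; lia.
rewrite -[LHS](mulKf m0) -h.
case: and3P => [[/eqP ea /eqP eb /eqP ee]|_]; last by rewrite mulr0.
by rewrite mulr1 mulr1n eb ee addnn -mul2n.
Qed.

Theorem theorem1p2 (R : realType) (k : nat) (hk : (2 <= k)%N) :
  ~ exists X : {fset {vspace dhomog 3 R[i]%C 1}},
      #|` X|%fset = ((k + 1) ^ 2 + 1)%N /\
      irredundant_waring_decomposition (3 * k) (xyz_power R[i]%C k) X.
Proof.
move=> [X [hX [[ell [hell [c hc]]] irr]]].
have c0 (p : X) : c (val p) != 0.
  apply/eqP => cp; apply: (irr (X `\ val p)%fset).
    exact: fproperD1 (valP p).
  exists ell; split; first by move=> q /fsetD1P [_ qX]; apply: hell.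
  by exists c; rewrite hc (big_fsetD1 (val p)) ?(valP p) //= cp scale0r add0r.
pose l (p : X) := ell (val p).
have lE (p : X) : l p != 0 /\ val p = <[l p]>%VS by apply/hell/valP.
have hg : xyz_power R[i]%C k =
    \sum_(p : X) c (val p) *: (l p : {mpoly (R[i]%C)[3]}) ^+ (3 * k).
  by rewrite hc big_seq_fsetE.
have C0 : ('C(3 * k, 2 * k) * 'C(2 * k, k))%:R^-1 != 0 :> R[i]%C.
  by rewrite invr_eq0 pnatr_eq0 muln_eq0 negb_or -!lt0n !bin_gt0; apply/andP; split; lia.
apply: (no_projective_points hk C0 c0 _ _ (fun a b e => moments_of_waring hg)).
- move=> p x0 y0 z0; have [/eqP l0 _] := lE p; apply: l0.
  by rewrite -(scale0r (l p)); apply: linear_form_scale; rewrite mul0r.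
(* Forms with proportional coordinates span the same line, hence are the same point of [X]. *)
- move=> p q s hx hy hz; apply/val_inj.
  have lpq := linear_form_scale hx hy hz.
  have [p0 ->] := lE p; have [q0 ->] := lE q.
  have s0 : s != 0 by apply: contra_neq p0 => s0; rewrite lpq s0 scale0r.
  apply/eqP; rewrite eqEsubv -!memvE lpq memvZ ?memv_line //=.
  by apply/vlineP; exists s^-1; rewrite scalerK.
- by rewrite -cardfE hX addn1 addn1.
Qed.
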